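(* Let $X$ be a non-empty set. Both the $(X\cup\overline{X})$-generated birestriction monoid $$F_p=\mathrm{BRestr}\langle X\cup\overline{X}\mid \overline{x}\ge x,\ x\in X\rangle$$ and the $(X\cup\overline{X^+})$-generated birestriction monoid $$\mathcal F_p=\mathrm{BRestr}\langle X\cup\overline{X^+}\mid \overline{x}\ge x\ (x\in X),\ \ \overline{uv}=\overline{u}\,\overline{v}\ (u,v\in X^+)\rangle$$ admit geometric models.
   Context: A birestriction monoid is an algebra $(S;\cdot,{}^*,{}^+,1)$ such that $(S;\cdot,1)$ is a monoid and for all $x,y$: $xx^*=x$, $x^*y^*=y^*x^*$, $(xy^* )^*=x^*y^*$, $x^*y=y(xy)^*$; $x^+x=x$, $x^+y^+=y^+x^+$, $(x^+y)^+=x^+y^+$, $xy^+=(xy)^+x$; $(x^+)^*=x^+$, $(x^* )^+=x^*$. An inverse monoid is regarded as a birestriction monoid via $a^*=a^{-1}a$, $a^+=aa^{-1}$. An inverse monoid is $E$-unitary if $s\ge e$ with $e$ idempotent implies that $s$ is idempotent. $X^+$ is the free semigroup on $X$; $\overline{X^+}=\{\overline{u}:u\in X^+\}$ is a set disjoint from $X$ in bijection with $X^+$, and $\overline{X}=\{\overline{x}:x\in X\}\subseteq\overline{X^+}$. $\mathrm{BRestr}\langle Y\mid R\rangle$ is the quotient of the free birestriction monoid on $Y$ by the congruence generated by $R$; a relation $a\ge b$ abbreviates $b=ab^*$ (equivalently $b=b^+a$). A $Y$-generated birestriction monoid $S$ admits a geometric model if there is an injective $(2,1,1,0)$-morphism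 (preserving $\cdot,{}^*,{}^+,1$) from $S$ into a $Y$-generated $E$-unitary inverse monoid which is $Y$-canonical, i.e. commutes with the assignment maps from $Y$. Here $Y=X\cup\overline{X}$ for $F_p$ and $Y=X\cup\overline{X^+}$ for $\mathcal F_p$. *)

(* Defs.v *)
From HB Require Import structures.
From mathcomp Require Import all_boot.
From mathcomp.classical Require Import boolp.

Set Implicit Arguments.
Unset Strict Implicit.
Unset Printing Implicit Defensive.

Import Algebra.
Local Open Scope group_scope.
Local Open Scope quotient_scope.

Reserved Notation "x ^[*]" (at level 1, left associativity, format "x ^[*]").
Reserved Notation "x ^[+]" (at level 1, left associativity, format "x ^[+]").

(* Algebras of signature (2,1,1,0), without axioms: terms and quotients live
   here before the birestriction identities are known to hold. *)
HB.mixin Record hasRestr S := {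
  rstar : S -> S;
  rplus : S -> S
}.

#[short(type="restrAlgType")]
HB.structure Definition RestrAlg := {S of hasRestr S & ChoiceBaseUMagma S}.

Notation "x ^[*]" := (rstar x) : group_scope.
Notation "x ^[+]" := (rplus x) : group_scope.

HB.mixin Record isBirestriction S of Monoid S & RestrAlg S := {
  mulg_rstar : forall x : S, x * x^[*] = x;
  rstarC : forall x y : S, x^[*] * y^[*] = y^[*] * x^[*];
  rstarMr : forall x y : S, (x * y^[*])^[*] = x^[*] * y^[*];
  rstar_mul : forall x y : S, x^[*] * y = y * (x * y)^[*];
  rplus_mulg : forall x : S, x^[+] * x = x;
  rplusC : forall x y : S, x^[+] * y^[+] = y^[+] * x^[+];
  rplusMl : forall x y : S, (x^[+] * y)^[+] = x^[+] * y^[+];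
  mul_rplus : forall x y : S, x * y^[+] = (x * y)^[+] * x;
  rplus_rstar : forall x : S, (x^[+])^[*] = x^[+];
  rstar_rplus : forall x : S, (x^[*])^[+] = x^[*]
}.

#[short(type="birestrMonoidType")]
HB.structure Definition BirestrMonoid :=
  {S of isBirestriction S & RestrAlg S & Monoid S}.

Definition restr_morphism (S T : restrAlgType) (f : S -> T) : Prop :=
  [/\ f 1 = 1, {morph f : x y / x * y}, {morph f : x / x^[*]} &
      {morph f : x / x^[+]}].

Definition natural_ge (S : birestrMonoidType) (a b : S) : Prop :=
  b = a * b^[*].

(* An inverse monoid carries its birestriction structure: the operations are
   forced by rstarE and rplusE, and the factory Monoid_isInverse below derives
   everything from the monoid and the existence of unique inverses. *)
HB.mixin Record isInverse M of BirestrMonoid M & StarMonoid M := {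
  mulgVKg : forall x : M, x * x^-1 * x = x;
  inverse_uniq : forall x y : M, x * y * x = x -> y * x * y = y -> y = x^-1;
  rstarE : forall x : M, x^[*] = x^-1 * x;
  rplusE : forall x : M, x^[+] = x * x^-1
}.

#[short(type="inverseMonoidType")]
HB.structure Definition InverseMonoid :=
  {M of isInverse M & BirestrMonoid M & StarMonoid M}.

HB.factory Record Monoid_isInverse M of Monoid M := {
  inv : M -> M;
  mul_inv_mul : forall x : M, x * inv x * x = x;
  inv_mul_inv : forall x : M, inv x * x * inv x = inv x;
  inv_uniq : forall x y : M, x * y * x = x -> y * x * y = y -> y = inv x
}.

HB.builders Context M of Monoid_isInverse M.

Let invE (x y : M) : x * y * x = x -> y * x * y = y -> inv x = y.
Proof. by move=> h1 h2; rewrite -(inv_uniq h1 h2). Qed.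

Let invK : involutive inv.
Proof. by move=> x; apply: invE; rewrite ?mul_inv_mul ?inv_mul_inv. Qed.

Let inv_idem (e : M) : e * e = e -> inv e = e.
Proof. by move=> he; apply: invE; rewrite !he. Qed.

Let mul_idem (e f : M) : e * e = e -> f * f = f -> (e * f) * (e * f) = e * f.
Proof.
move=> he hf; set x := inv (e * f).
have h1 : e * f * x * (e * f) = e * f by rewrite mul_inv_mul.
have h2 : x * (e * f) * x = x by rewrite inv_mul_inv.
have hx : x = f * x * e.
  apply: invE.
    transitivity (e * (f * f) * x * (e * e) * f); first by rewrite !mulgA.
    by rewrite he hf -[RHS]h1 !mulgA.
  transitivity (f * x * (e * e) * (f * f) * x * e); first by rewrite !mulgA.
  by rewrite he hf -[in RHS]h2 !mulgA.
have xx : x * x = x.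
  rewrite {1 2}hx; transitivity (f * (x * (e * f) * x) * e).
    by rewrite !mulgA.
  by rewrite h2 -hx.
have -> : e * f = x by rewrite -[LHS]invK -/x inv_idem.
exact: xx.
Qed.

Let idemC (e f : M) : e * e = e -> f * f = f -> e * f = f * e.
Proof.
move=> he hf; rewrite -[LHS]inv_idem; last exact: mul_idem.
apply: invE.
  transitivity (e * (f * f) * (e * e) * f); first by rewrite !mulgA.
  by rewrite he hf -[RHS]mul_idem // !mulgA.
transitivity (f * (e * e) * (f * f) * e); first by rewrite !mulgA.
by rewrite he hf -[RHS]mul_idem // !mulgA.
Qed.

Let idemVl (x : M) : (inv x * x) * (inv x * x) = inv x * x.
Proof. by rewrite mulgA inv_mul_inv. Qed.

Let idemVr (x : M) : (x * inv x) * (x * inv x) = x * inv x.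
Proof. by rewrite mulgA mul_inv_mul. Qed.

Let invM : {morph inv : x y / x * y >-> y * x}.
Proof.
move=> x y; apply: invE.
  transitivity (x * ((y * inv y) * (inv x * x)) * y); first by rewrite !mulgA.
  rewrite (idemC (idemVr y) (idemVl x)).
  transitivity ((x * inv x * x) * (y * inv y * y)); first by rewrite !mulgA.
  by rewrite !mul_inv_mul.
transitivity (inv y * ((inv x * x) * (y * inv y)) * inv x).
  by rewrite !mulgA.
rewrite (idemC (idemVl x) (idemVr y)).
transitivity ((inv y * y * inv y) * (inv x * x * inv x)).
  by rewrite !mulgA.
by rewrite !inv_mul_inv.
Qed.

HB.instance Definition _ := hasInv.Build M inv.
HB.instance Definition _ := Monoid_isStarMonoid.Build M invK invM.
HB.instance Definition _ :=
  hasRestr.Build M (fun x => inv x * x) (fun x => x * inv x).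

Let mulS (x : M) : x * x^[*] = x.
Proof. by rewrite /rstar /= mulgA mul_inv_mul. Qed.

Let SC (x y : M) : x^[*] * y^[*] = y^[*] * x^[*].
Proof. by apply: idemC; apply: idemVl. Qed.

Let SMr (x y : M) : (x * y^[*])^[*] = x^[*] * y^[*].
Proof.
rewrite {1}/rstar /= invM (inv_idem (idemVl y)).
transitivity (y^[*] * (x^[*] * y^[*])); first by rewrite /rstar /= !mulgA.
by rewrite SC mulgA idemVl.
Qed.

Let S_mul (x y : M) : x^[*] * y = y * (x * y)^[*].
Proof.
rewrite /rstar /= invM.
transitivity ((y * inv y) * (inv x * x) * y); last by rewrite !mulgA.
by rewrite (idemC (idemVr y) (idemVl x)) -!mulgA (mulgA y) mul_inv_mul.
Qed.

Let Pmul (x : M) : x^[+] * x = x.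
Proof. exact: mul_inv_mul. Qed.

Let PC (x y : M) : x^[+] * y^[+] = y^[+] * x^[+].
Proof. by apply: idemC; apply: idemVr. Qed.

Let PMl (x y : M) : (x^[+] * y)^[+] = x^[+] * y^[+].
Proof.
rewrite {1}/rplus /= invM (inv_idem (idemVr x)).
transitivity (x^[+] * y^[+] * x^[+]); first by rewrite /rplus /= !mulgA.
by rewrite -mulgA (PC y x) mulgA idemVr.
Qed.

Let mulP (x y : M) : x * y^[+] = (x * y)^[+] * x.
Proof.
rewrite /rplus /= invM.
transitivity (x * ((y * inv y) * (inv x * x))); last by rewrite !mulgA.
by rewrite (idemC (idemVr y) (idemVl x)) !mulgA mul_inv_mul.
Qed.

Let PS (x : M) : (x^[+])^[*] = x^[+].
Proof. by rewrite {1}/rstar /= (inv_idem (idemVr x)) idemVr. Qed.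

Let SP (x : M) : (x^[*])^[+] = x^[*].
Proof. by rewrite {1}/rplus /= (inv_idem (idemVl x)) idemVl. Qed.

HB.instance Definition _ :=
  isBirestriction.Build M mulS SC SMr S_mul Pmul PC PMl mulP PS SP.
HB.instance Definition _ :=
  isInverse.Build M mul_inv_mul inv_uniq
    (fun x => erefl (x^[*])) (fun x => erefl (x^[+])).

HB.end.

Definition E_unitary (M : inverseMonoidType) : Prop :=
  forall s e : M, e * e = e -> natural_ge s e -> s * s = s.

Section Generation.
Variable Y : Type.

Definition restr_generates (S : restrAlgType) (i : Y -> S) : Prop :=
  forall P : S -> Prop,
    (forall y, P (i y)) -> P 1 -> (forall a b, P a -> P b -> P (a * b)) ->
    (forall a, P a -> P a^[*]) -> (forall a, P a -> P a^[+]) ->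
  forall s, P s.

Definition inverse_generates (M : inverseMonoidType) (j : Y -> M) : Prop :=
  forall P : M -> Prop,
    (forall y, P (j y)) -> P 1 -> (forall a b, P a -> P b -> P (a * b)) ->
    (forall a, P a -> P a^-1) ->
  forall s, P s.

(* The assignment map is not required to be injective. *)
Record generatedBirestr := GeneratedBirestr {
  gb_sort :> birestrMonoidType;
  gb_assign : Y -> gb_sort;
  gb_generates : restr_generates gb_assign
}.

Record generatedInverse := GeneratedInverse {
  gi_sort :> inverseMonoidType;
  gi_assign : Y -> gi_sort;
  gi_generates : inverse_generates gi_assign
}.

Definition admits_geometric_model (S : generatedBirestr) : Prop :=
  exists (M : generatedInverse) (f : S -> M),
    [/\ E_unitary M, restr_morphism f, injective f &
        forall y, f (gb_assign S y) = gi_assign M y].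

End Generation.

Section Quotient.
Variables (A : restrAlgType) (R : A -> A -> Prop).

Inductive gen_congr : A -> A -> Prop :=
| gc_base a b : R a b -> gen_congr a b
| gc_refl a : gen_congr a a
| gc_sym a b : gen_congr a b -> gen_congr b a
| gc_trans a b c : gen_congr a b -> gen_congr b c -> gen_congr a c
| gc_mul a b c d : gen_congr a b -> gen_congr c d ->
    gen_congr (a * c) (b * d)
| gc_star a b : gen_congr a b -> gen_congr a^[*] b^[*]
| gc_plus a b : gen_congr a b -> gen_congr a^[+] b^[+].

Definition gen_congrb (a b : A) : bool := `[< gen_congr a b >].

Lemma gen_congrb_refl : reflexive gen_congrb.
Proof. by move=> a; apply/asboolP; apply: gc_refl. Qed.

Lemma gen_congrb_sym : symmetric gen_congrb.
Proof. by move=> a b; apply/asboolP/asboolP; apply: gc_sym. Qed.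

Lemma gen_congrb_trans : transitive gen_congrb.
Proof. by move=> b a c /asboolP ab /asboolP bc; apply/asboolP/(gc_trans ab). Qed.

Canonical gen_congr_equiv :=
  EquivRel gen_congrb gen_congrb_refl gen_congrb_sym gen_congrb_trans.

Definition quot : Type := {eq_quot gen_congr_equiv}.
HB.instance Definition _ := Choice.on quot.
HB.instance Definition _ := EqQuotient.on quot.

Lemma quot_eqP (a b : A) : \pi_quot a = \pi_quot b <-> gen_congr a b.
Proof.
by split=> [/eqP|h]; [rewrite piE => /asboolP|apply/eqP; rewrite piE; apply/asboolP].
Qed.

Definition quot_mul : quot -> quot -> quot := lift_op2 quot (@mul A).
Definition quot_star : quot -> quot := lift_op1 quot (@rstar A).
Definition quot_plus : quot -> quot := lift_op1 quot (@rplus A).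

HB.instance Definition _ := hasMul.Build quot quot_mul.
HB.instance Definition _ := hasOne.Build quot (\pi_quot 1).
HB.instance Definition _ := hasRestr.Build quot quot_star quot_plus.

Lemma pi_restr_morphism : restr_morphism (\pi_quot : A -> quot).
Proof.
have reprE a : gen_congr a (repr (\pi_quot a)).
  by apply/quot_eqP; rewrite reprK.
split=> // [a b|a|a].
- by rewrite /mul /= /quot_mul -lock; apply/quot_eqP; exact: gc_mul.
- by rewrite /rstar /= /quot_star -lock; apply/quot_eqP; exact: gc_star.
- by rewrite /rplus /= /quot_plus -lock; apply/quot_eqP; exact: gc_plus.
Qed.

Lemma pi_generates (Y : Type) (i : Y -> A) :
  restr_generates i -> restr_generates (fun y => \pi_quot (i y)).
Proof.
have [h1 hM hS hP] := pi_restr_morphism.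
move=> gen P Pi P1 PM PS PP p; rewrite -[p]reprK.
apply: (gen (fun a => P (\pi_quot a))) => // [a b|a|a].
- by rewrite hM; apply: PM.
- by rewrite hS; apply: PS.
- by rewrite hP; apply: PP.
Qed.

End Quotient.

Section QuotientBirestr.
Variables (S : birestrMonoidType) (R : S -> S -> Prop).
Local Notation Q := (quot R).
Local Notation pi := (\pi_(quot R) : S -> Q).

Let mor := pi_restr_morphism R.
Let pi1 : pi 1 = 1. Proof. by case: mor. Qed.
Let piM x y : pi (x * y) = pi x * pi y. Proof. by case: mor. Qed.
Let piS x : pi x^[*] = (pi x)^[*]. Proof. by case: mor. Qed.
Let piP x : pi x^[+] = (pi x)^[+]. Proof. by case: mor. Qed.
Let pi_surj (p : Q) : exists x, p = pi x.
Proof. by exists (repr p); rewrite reprK. Qed.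

Let qmulA : associative (@mul Q).
Proof.
move=> x y z; case: (pi_surj x) => {}x ->; case: (pi_surj y) => {}y ->.
by case: (pi_surj z) => {}z ->; rewrite -!piM mulgA.
Qed.
Let qmul1 : left_id 1 (@mul Q).
Proof. by move=> x; case: (pi_surj x) => {}x ->; rewrite -pi1 -piM mul1g. Qed.
Let qmulr1 : right_id 1 (@mul Q).
Proof. by move=> x; case: (pi_surj x) => {}x ->; rewrite -pi1 -piM mulg1. Qed.

HB.instance Definition _ := Magma_isSemigroup.Build Q qmulA.
HB.instance Definition _ := BaseUMagma_isUMagma.Build Q qmul1 qmulr1.

Let q1 (x : Q) : x * x^[*] = x.
Proof. by case: (pi_surj x) => {}x ->; rewrite -piS -piM mulg_rstar. Qed.
Let q2 (x y : Q) : x^[*] * y^[*] = y^[*] * x^[*].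
Proof. by case: (pi_surj x) => {}x ->; case: (pi_surj y) => {}y ->; rewrite -!piS -!piM rstarC. Qed.
Let q3 (x y : Q) : (x * y^[*])^[*] = x^[*] * y^[*].
Proof.
by case: (pi_surj x) => {}x ->; case: (pi_surj y) => {}y ->;
  rewrite -!piS -!piM -!piS rstarMr.
Qed.
Let q4 (x y : Q) : x^[*] * y = y * (x * y)^[*].
Proof.
by case: (pi_surj x) => {}x ->; case: (pi_surj y) => {}y ->;
  rewrite -!(piS, piM) rstar_mul.
Qed.
Let q5 (x : Q) : x^[+] * x = x.
Proof. by case: (pi_surj x) => {}x ->; rewrite -piP -piM rplus_mulg. Qed.
Let q6 (x y : Q) : x^[+] * y^[+] = y^[+] * x^[+].
Proof. by case: (pi_surj x) => {}x ->; case: (pi_surj y) => {}y ->; rewrite -!piP -!piM rplusC. Qed.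
Let q7 (x y : Q) : (x^[+] * y)^[+] = x^[+] * y^[+].
Proof.
by case: (pi_surj x) => {}x ->; case: (pi_surj y) => {}y ->;
  rewrite -!(piP, piM) rplusMl.
Qed.
Let q8 (x y : Q) : x * y^[+] = (x * y)^[+] * x.
Proof.
by case: (pi_surj x) => {}x ->; case: (pi_surj y) => {}y ->;
  rewrite -!(piP, piM) mul_rplus.
Qed.
Let q9 (x : Q) : (x^[+])^[*] = x^[+].
Proof. by case: (pi_surj x) => {}x ->; rewrite -piP -piS rplus_rstar. Qed.
Let q10 (x : Q) : (x^[*])^[+] = x^[*].
Proof. by case: (pi_surj x) => {}x ->; rewrite -piS -piP rstar_rplus. Qed.

HB.instance Definition _ :=
  isBirestriction.Build Q q1 q2 q3 q4 q5 q6 q7 q8 q9 q10.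

End QuotientBirestr.

Section Free.
Variable Y : Type.

Inductive term : Type :=
| Gen of Y
| One
| Mul of term & term
| Star of term
| Plus of term.

HB.instance Definition _ := gen_eqMixin term.
HB.instance Definition _ := gen_choiceMixin term.
HB.instance Definition _ := hasMul.Build term Mul.
HB.instance Definition _ := hasOne.Build term One.
HB.instance Definition _ := hasRestr.Build term Star Plus.

Inductive birestr_axiom : term -> term -> Prop :=
| ax_mulA x y z : birestr_axiom (x * (y * z)) (x * y * z)
| ax_mul1g x : birestr_axiom (1 * x) x
| ax_mulg1 x : birestr_axiom (x * 1) x
| ax_mulg_rstar x : birestr_axiom (x * x^[*]) x
| ax_rstarC x y : birestr_axiom (x^[*] * y^[*]) (y^[*] * x^[*])
| ax_rstarMr x y : birestr_axiom (x * y^[*])^[*] (x^[*] * y^[*])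
| ax_rstar_mul x y : birestr_axiom (x^[*] * y) (y * (x * y)^[*])
| ax_rplus_mulg x : birestr_axiom (x^[+] * x) x
| ax_rplusC x y : birestr_axiom (x^[+] * y^[+]) (y^[+] * x^[+])
| ax_rplusMl x y : birestr_axiom (x^[+] * y)^[+] (x^[+] * y^[+])
| ax_mul_rplus x y : birestr_axiom (x * y^[+]) ((x * y)^[+] * x)
| ax_rplus_rstar x : birestr_axiom (x^[+])^[*] x^[+]
| ax_rstar_rplus x : birestr_axiom (x^[*])^[+] x^[*].

Definition freeBirestr : Type := quot birestr_axiom.
HB.instance Definition _ := RestrAlg.on freeBirestr.
HB.instance Definition _ := EqQuotient.on freeBirestr.

Local Notation F := freeBirestr.
Local Notation pi := (\pi_(quot birestr_axiom) : term -> F).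

Let mor := pi_restr_morphism birestr_axiom.
Let pi1 : pi 1 = 1. Proof. by case: mor. Qed.
Let piM x y : pi (x * y) = pi x * pi y. Proof. by case: mor. Qed.
Let piS x : pi x^[*] = (pi x)^[*]. Proof. by case: mor. Qed.
Let piP x : pi x^[+] = (pi x)^[+]. Proof. by case: mor. Qed.
Let pi_surj (p : F) : exists x, p = pi x.
Proof. by exists (repr p); rewrite reprK. Qed.
Let pi_ax x y : birestr_axiom x y -> pi x = pi y.
Proof. by move=> h; apply/quot_eqP; apply: gc_base. Qed.

Let fmulA : associative (@mul F).
Proof.
move=> x y z; case: (pi_surj x) => {}x ->; case: (pi_surj y) => {}y ->.
by case: (pi_surj z) => {}z ->; rewrite -!piM; apply: pi_ax; constructor.
Qed.
Let fmul1 : left_id 1 (@mul F).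
Proof. by move=> x; case: (pi_surj x) => {}x ->; rewrite -pi1 -piM; apply: pi_ax; constructor. Qed.
Let fmulr1 : right_id 1 (@mul F).
Proof. by move=> x; case: (pi_surj x) => {}x ->; rewrite -pi1 -piM; apply: pi_ax; constructor. Qed.

HB.instance Definition _ := Magma_isSemigroup.Build F fmulA.
HB.instance Definition _ := BaseUMagma_isUMagma.Build F fmul1 fmulr1.

Let f1 (x : F) : x * x^[*] = x.
Proof. by case: (pi_surj x) => {}x ->; rewrite -!(piS, piM); apply: pi_ax; constructor. Qed.
Let f2 (x y : F) : x^[*] * y^[*] = y^[*] * x^[*].
Proof.
by case: (pi_surj x) => {}x ->; case: (pi_surj y) => {}y ->; rewrite -!(piS, piM);
  apply: pi_ax; constructor.
Qed.
Let f3 (x y : F) : (x * y^[*])^[*] = x^[*] * y^[*].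
Proof.
by case: (pi_surj x) => {}x ->; case: (pi_surj y) => {}y ->; rewrite -!(piS, piM);
  apply: pi_ax; constructor.
Qed.
Let f4 (x y : F) : x^[*] * y = y * (x * y)^[*].
Proof.
by case: (pi_surj x) => {}x ->; case: (pi_surj y) => {}y ->; rewrite -!(piS, piM);
  apply: pi_ax; constructor.
Qed.
Let f5 (x : F) : x^[+] * x = x.
Proof. by case: (pi_surj x) => {}x ->; rewrite -!(piP, piM); apply: pi_ax; constructor. Qed.
Let f6 (x y : F) : x^[+] * y^[+] = y^[+] * x^[+].
Proof.
by case: (pi_surj x) => {}x ->; case: (pi_surj y) => {}y ->; rewrite -!(piP, piM);
  apply: pi_ax; constructor.
Qed.
Let f7 (x y : F) : (x^[+] * y)^[+] = x^[+] * y^[+].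
Proof.
by case: (pi_surj x) => {}x ->; case: (pi_surj y) => {}y ->; rewrite -!(piP, piM);
  apply: pi_ax; constructor.
Qed.
Let f8 (x y : F) : x * y^[+] = (x * y)^[+] * x.
Proof.
by case: (pi_surj x) => {}x ->; case: (pi_surj y) => {}y ->; rewrite -!(piP, piM);
  apply: pi_ax; constructor.
Qed.
Let f9 (x : F) : (x^[+])^[*] = x^[+].
Proof. by case: (pi_surj x) => {}x ->; rewrite -!(piS, piP); apply: pi_ax; constructor. Qed.
Let f10 (x : F) : (x^[*])^[+] = x^[*].
Proof. by case: (pi_surj x) => {}x ->; rewrite -!(piS, piP); apply: pi_ax; constructor. Qed.

HB.instance Definition _ :=
  isBirestriction.Build F f1 f2 f3 f4 f5 f6 f7 f8 f9 f10.

Definition free_gen (y : Y) : freeBirestr := pi (Gen y).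

Lemma free_generates : restr_generates free_gen.
Proof.
apply: pi_generates => P Pg P1 PM PS PP.
by elim=> [y||a Pa b Pb|a Pa|a Pa]; [apply: Pg| |apply: PM|apply: PS|apply: PP].
Qed.

Definition BRestr (R : freeBirestr -> freeBirestr -> Prop) :
    generatedBirestr Y :=
  @GeneratedBirestr Y (quot R) (fun y => \pi_(quot R) (free_gen y))
    (pi_generates free_generates).

End Free.

Section FreeSemigroup.
Variable X : Type.

Definition freeSemigroup : Type := {w : seq X | ~~ nilp w}.
HB.instance Definition _ := gen_eqMixin freeSemigroup.
HB.instance Definition _ := gen_choiceMixin freeSemigroup.

Lemma nonnil_cat (u v : freeSemigroup) : ~~ nilp (val u ++ val v).
Proof. by case: u => [[]]. Qed.

Definition fs_mul (u v : freeSemigroup) : freeSemigroup :=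
  exist _ (val u ++ val v) (nonnil_cat u v).

Lemma fs_mulA : associative fs_mul.
Proof. by move=> u v w; apply: val_inj; rewrite /= catA. Qed.

HB.instance Definition _ := isSemigroup.Build freeSemigroup fs_mulA.

Definition letter (x : X) : freeSemigroup := exist _ [:: x] isT.

End FreeSemigroup.

(* In both presentations inl x is the generator x and inr u is the generator
   written with a bar; the relation a >= b stands for the pair (b, a b^* ). *)
Variant Fp_rel (X : Type) :
    freeBirestr (X + X) -> freeBirestr (X + X) -> Prop :=
| Fp_ge x : Fp_rel (free_gen (inl x))
                   (free_gen (inr x) * (free_gen (inl x))^[*]).

Definition Fp (X : Type) : generatedBirestr (X + X) := BRestr (@Fp_rel X).

Variant calFp_rel (X : Type) :
    freeBirestr (X + freeSemigroup X) -> freeBirestr (X + freeSemigroup X) ->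
    Prop :=
| calFp_ge x : calFp_rel (free_gen (inl x))
                 (free_gen (inr (letter x)) * (free_gen (inl x))^[*])
| calFp_mul u v : calFp_rel (free_gen (inr (u * v)))
                 (free_gen (inr u) * free_gen (inr v)).

Definition calFp (X : Type) : generatedBirestr (X + freeSemigroup X) :=
  BRestr (@calFp_rel X).

(* Main.v *)
(** Every element is [s = s^+ b_w], where the word [w] over [X] is its degree
    and [b_w] is the product of the barred letters of [w]; hence [s] is
    determined by [s^+] and [w].  A barred letter [b] acts on the projections by
    the partial bijection [f |-> (b f)^+] from the ideal below [b^*] onto the
    ideal below [b^+].  Extend these partial bijections in any way to
    permutations [pi_x] of a larger set, and send [s] to the pair of the ideal
    below [s^+] and [pi_w] in the semidirect product of the subsets by the
    permutations, which is E-unitary.  This is a morphism whatever the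
    extensions are, because the ideal below [b^+] is already the image of the
    ideal below [b^*].  In the second presentation [ubar] is forced to be the
    product of its barred letters, so the same argument applies. *)
From HB Require Import structures.
From mathcomp Require Import all_boot.
From mathcomp.classical Require Import boolp.
Require Import Defs.

Set Implicit Arguments.
Unset Strict Implicit.
Unset Printing Implicit Defensive.

Import Algebra.
Local Open Scope group_scope.
Local Open Scope quotient_scope.

(** * Identities for projections in a birestriction monoid *)

Section BirestrTheory.
Variable S : birestrMonoidType.
Implicit Types x y e f : S.

Lemma rplus1 : (1 : S)^[+] = 1.
Proof. by rewrite -[LHS]mulg1 rplus_mulg. Qed.

Lemma rplusK x : x^[+]^[+] = x^[+].
Proof. by rewrite -{1}(rplus_rstar x) rstar_rplus rplus_rstar. Qed.

Lemma rplus_idem x : x^[+] * x^[+] = x^[+].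
Proof. by rewrite -rplusMl rplus_mulg. Qed.

Lemma rplusMle x y : x^[+] * (x * y)^[+] = (x * y)^[+].
Proof. by rewrite -rplusMl mulgA rplus_mulg. Qed.

Lemma rstarMle x y : (x * y)^[*] * y^[*] = (x * y)^[*].
Proof. by rewrite -rstarMr -mulgA mulg_rstar. Qed.

Lemma rplusMr x y : (x * y^[+])^[+] = (x * y)^[+].
Proof. by rewrite mul_rplus rplusMl rplusC rplusMle. Qed.

Lemma rstarMl x y : (x^[*] * y)^[*] = (x * y)^[*].
Proof. by rewrite rstar_mul rstarMr rstarC rstarMle. Qed.

Lemma proj_rstar f : f^[+] = f -> f^[*] = f.
Proof. by move=> <-; exact: rplus_rstar. Qed.

Lemma rstarM_proj x f : f^[+] = f -> (x * f)^[*] = x^[*] * f.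
Proof. by move=> /proj_rstar fS; rewrite -{1}fS rstarMr fS. Qed.

Lemma rplusM_proj x f : f^[+] = f -> (f * x)^[+] = f * x^[+].
Proof. by move=> fP; rewrite -{1}fP rplusMl fP. Qed.

Lemma projC e f : e^[+] = e -> f^[+] = f -> e * f = f * e.
Proof. by move=> <- <-; exact: rplusC. Qed.

Lemma natural_ge_rplus x y : natural_ge x y -> y = y^[+] * x.
Proof. by move=> xy; have := mul_rplus x y^[*]; rewrite rstar_rplus -xy. Qed.

End BirestrTheory.

(** * Universal properties of quotients, free objects and presentations *)

Lemma quot_lift (A T : restrAlgType) (R : A -> A -> Prop) (h : A -> T) :
    restr_morphism h -> (forall a b, R a b -> h a = h b) ->
  exists2 h' : quot R -> T,
    restr_morphism h' & forall a, h' (\pi_(quot R) a) = h a.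
Proof.
move=> [h1 hM hS hP] hR.
have hcong a b : gen_congr R a b -> h a = h b.
  elim=> {a b} [a b /hR //|//|//|a b c _ -> //|a b c d _ e1 _ e2|a b _ e|a b _ e].
  - by rewrite !hM e1 e2.
  - by rewrite !hS e.
  - by rewrite !hP e.
have hpi a : h (repr (\pi_(quot R) a)) = h a.
  by apply/hcong/quot_eqP; rewrite reprK.
have [p1 pM pS pP] := pi_restr_morphism R.
exists (fun p => h (repr p)) => //; split=> [|p q|p|p].
- by rewrite -p1 hpi.
- by rewrite -{1}[p]reprK -{1}[q]reprK -pM hpi hM.
- by rewrite -{1}[p]reprK -pS hpi hS.
- by rewrite -{1}[p]reprK -pP hpi hP.
Qed.

Fixpoint term_eval (Y : Type) (T : restrAlgType) (i : Y -> T) (t : term Y) : T :=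
  match t with
  | Gen y => i y
  | One => 1
  | Mul a b => term_eval i a * term_eval i b
  | Star a => (term_eval i a)^[*]
  | Plus a => (term_eval i a)^[+]
  end.

Lemma freeBirestr_lift (Y : Type) (T : birestrMonoidType) (i : Y -> T) :
  exists2 h : freeBirestr Y -> T,
    restr_morphism h & forall y, h (free_gen y) = i y.
Proof.
have [||h hmor hE] :=
  @quot_lift (term Y) T (@birestr_axiom Y) (term_eval i).
- by split.
- move=> a b; case=> * /=; [exact: mulgA|exact: mul1g|exact: mulg1
    |exact: mulg_rstar|exact: rstarC|exact: rstarMr|exact: rstar_mul
    |exact: rplus_mulg|exact: rplusC|exact: rplusMl|exact: mul_rplus
    |exact: rplus_rstar|exact: rstar_rplus].
- by exists h => // y; rewrite hE.
Qed.

Lemma BRestr_lift (Y : Type) (R : freeBirestr Y -> freeBirestr Y -> Prop)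
    (T : birestrMonoidType) (i : Y -> T) :
    (forall h : freeBirestr Y -> T, restr_morphism h ->
       (forall y, h (free_gen y) = i y) -> forall a b, R a b -> h a = h b) ->
  exists2 h : BRestr R -> T,
    restr_morphism h & forall y, h (gb_assign (BRestr R) y) = i y.
Proof.
move=> hR; have [g gmor gE] := freeBirestr_lift i.
have [h hmor hE] := quot_lift gmor (hR g gmor gE).
by exists h => // y; rewrite hE.
Qed.

(** * The free monoid as the target of the degree *)

Section Words.
Variable X : Type.

Definition words : Type := seq X.
HB.instance Definition _ := gen_eqMixin words.
HB.instance Definition _ := gen_choiceMixin words.

Let wmulA : associative (@cat X : words -> words -> words).
Proof. exact: catA. Qed.
Let wmul1 : left_id ([::] : words) (@cat X). Proof. exact: cat0s. Qed.
Let wmulr1 : right_id ([::] : words) (@cat X). Proof. exact: cats0. Qed.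

HB.instance Definition _ := isMonoid.Build words wmulA wmul1 wmulr1.
(** With constant unary operations every projection is trivial, so a morphism into [words] records
    the degree only, and a relation [a >= b] just says that [a] and [b] have the same degree. *)
HB.instance Definition _ := hasRestr.Build words (fun=> [::]) (fun=> [::]).

Let wK (x : words) : x * [::] = x. Proof. exact: cats0. Qed.

HB.instance Definition _ := isBirestriction.Build words
  wK (fun _ _ => erefl) (fun _ _ => erefl) (fun x y => esym (wK y))
  (fun _ => erefl) (fun _ _ => erefl) (fun _ _ => erefl) (fun x _ => wK x)
  (fun _ => erefl) (fun _ => erefl).

End Words.

(** * The E-unitary inverse monoid spanned by a family of triples *)

(* The triple (A, f, g) stands for the pair of the set A and the permutation f
   with inverse g, in the semidirect product of sets by permutations. *)
Section SemidirectTriples.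
Variable Omega : Type.

Definition triple : Type :=
  (Omega -> Prop) * (Omega -> Omega) * (Omega -> Omega).
Implicit Types t u : triple.

Definition tmul t u : triple :=
  (fun w => t.1.1 w /\ u.1.1 (t.2 w), t.1.2 \o u.1.2, u.2 \o t.2).

Definition tinv t : triple := (t.1.1 \o t.1.2, t.2, t.1.2).

Definition tone (B : Omega -> Prop) : triple := (B, id, id).

Lemma tmulA : associative tmul.
Proof.
move=> [[A f] f'] [[B g] g'] [[C h] h']; congr (_, _, _).
by apply/funext => w /=; apply/propext; split=> [[? []]|[[]]].
Qed.

End SemidirectTriples.

(* B is the top of the semilattice: the unit is (B, id) even though B need not
   be the whole of Omega. *)
Section GeneratedTriples.
Variables (Omega Y : Type) (B : Omega -> Prop) (j : Y -> triple Omega).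
Implicit Types t u : triple Omega.

(** The containment of [A] in [B] makes [tone B] a left unit; that of the image of [A] under the
    inverse permutation makes it a right unit. *)
Definition wf_triple t :=
  [/\ cancel t.1.2 t.2, cancel t.2 t.1.2 &
      forall w, t.1.1 w -> B w /\ B (t.2 w)].

Inductive in_span : triple Omega -> Prop :=
| span_gen y : in_span (j y)
| span_one : in_span (tone B)
| span_mul t u : in_span t -> in_span u -> in_span (tmul t u)
| span_inv t : in_span t -> in_span (tinv t).

Hypothesis j_wf : forall y, wf_triple (j y).

Lemma span_wf t : in_span t -> wf_triple t.
Proof.
elim=> {t} [y //||t u _ [tK tV tB] _ [uK uV uB]|t _ [tK tV tB]].
- by split.
- split=> /= [w|w|w [/tB[Bw _] /uB[_ Bu]]] //=; first by rewrite tK uK.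
  by rewrite uV tV.
- by split=> //= w /tB; rewrite tK => -[].
Qed.

Definition span : Type := {t | in_span t}.
HB.instance Definition _ := gen_eqMixin span.
HB.instance Definition _ := gen_choiceMixin span.

Lemma span_inj (s t : span) : sval s = sval t -> s = t.
Proof. by case: s t => s ps [t pt] /= e; exact: eq_exist. Qed.

Let smul (s t : span) : span :=
  exist _ _ (span_mul (proj2_sig s) (proj2_sig t)).
Let sone : span := exist _ _ span_one.
Let sinv (s : span) : span := exist _ _ (span_inv (proj2_sig s)).

Let smulA : associative smul.
Proof. by move=> s t u; apply: span_inj; exact: tmulA. Qed.

Let smul1 : left_id sone smul.
Proof.
case=> -[[A f] g] st; apply: span_inj; congr (_, _, _).
have [_ _ AB] := span_wf st.
by apply/funext => w /=; apply/propext; split=> [[]|Aw] //; have [] := AB w Aw.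
Qed.

Let smulr1 : right_id sone smul.
Proof.
case=> -[[A f] g] st; apply: span_inj; congr (_, _, _).
have [_ _ AB] := span_wf st.
by apply/funext => w /=; apply/propext; split=> [[]|Aw] //; have [] := AB w Aw.
Qed.

HB.instance Definition _ := isMonoid.Build span smulA smul1 smulr1.

Let smulV (s : span) : s * sinv s * s = s.
Proof.
case: s => -[[A f] g] st; apply: span_inj.
have [/= fK gK _] := span_wf st.
congr (_, _, _); apply/funext => w /=; rewrite ?gK ?fK //.
by apply/propext; split=> [[[]]|].
Qed.

Let sinvV (s : span) : sinv s * s * sinv s = sinv s.
Proof.
case: s => -[[A f] g] st; apply: span_inj.
have [/= fK gK _] := span_wf st.
congr (_, _, _); apply/funext => w /=; rewrite ?gK ?fK //.
by apply/propext; split=> [[[]]|].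
Qed.

Let sinv_uniq (s t : span) : s * t * s = s -> t * s * t = t -> t = sinv s.
Proof.
case: s t => -[[A f] g] ps [[[C h] k] pt].
move=> /(congr1 sval)[/= As fs gs] /(congr1 sval)[/= Ct ht kt].
apply: span_inj; rewrite /= /tinv /=.
have [/= fK gK _] := span_wf ps; have [/= hK kK _] := span_wf pt.
have hE : h = g.
  apply/funext => w; apply: (can_inj fK); rewrite gK.
  by have /= := congr1 (@^~ (g w)) fs; rewrite gK.
have kE : k = f.
  apply/funext => w; apply: (can_inj hK); rewrite kK hE fK //.
(* The permutations now being mutually inverse, each of the two equations yields one inclusion
   between the sets. *)
subst h k; congr (_, _, _); apply/funext => w /=; apply/propext; split.
- by rewrite -{1}Ct => -[[_]].
- by rewrite -{1}As => -[[_]]; rewrite /= fK.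
Qed.

HB.instance Definition _ := Monoid_isInverse.Build span smulV sinvV sinv_uniq.

Definition span_assign (y : Y) : span := exist _ _ (span_gen y).

Lemma span_generates : inverse_generates span_assign.
Proof.
move=> P Pg P1 PM PV.
suff gen t : in_span t -> forall s : span, sval s = t -> P s.
  by move=> s; exact: gen (proj2_sig s) _ erefl.
elim=> {t} [y||t u pt IHt pu IHu|t pt IHt] s st.
- by rewrite (_ : s = span_assign y) //; exact: span_inj.
- by rewrite (_ : s = sone) //; exact: span_inj.
- rewrite (_ : s = smul (exist _ t pt) (exist _ u pu)); last exact: span_inj.
  by apply: PM; [exact: IHt|exact: IHu].
- rewrite (_ : s = sinv (exist _ t pt)); last exact: span_inj.
  by apply: PV; exact: IHt.
Qed.

(** An idempotent has the identity as its permutation, comparable elements share their permutation,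
    and a triple over the identity is idempotent. *)
Lemma span_E_unitary : E_unitary span.
Proof.
case=> -[[A f] g] ps [[[C h] k] pt].
move=> /(congr1 sval)[/= _ hh _] /(congr1 sval)[/= _ hf _].
have [/= hK kK _] := span_wf pt; have [/= fK gK _] := span_wf ps.
have h1 : h = id.
  apply/funext => w; apply: (can_inj hK).
  by have /= := congr1 (@^~ w) hh.
have f1 : f = id.
  by apply/funext => w; have /= := congr1 (@^~ w) hf; rewrite hK h1 /= => <-.
have g1 : g = id.
  by apply/funext => w; have := gK w; rewrite f1.
apply: span_inj; rewrite /= /tmul /= f1 g1; congr (_, _, _).
by apply/funext => w /=; apply/propext; split=> [[]|].
Qed.

End GeneratedTriples.

(* A partial bijection p from D to R with inverse q extends to a permutation of
   two copies of its carrier: outside D the identity moves to the second copy,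
   where q acts from R to D and the identity returns from outside R. *)
Section Dilation.
Variables (K : Type) (D R : K -> Prop) (p q : K -> K).

Definition dilation (w : K * bool) : K * bool :=
  if w.2 then (if `[< R w.1 >] then (q w.1, true) else (w.1, false))
  else (if `[< D w.1 >] then (p w.1, false) else (w.1, true)).

End Dilation.

Lemma dilationK (K : Type) (D R : K -> Prop) (p q : K -> K) :
    (forall k, D k -> R (p k) /\ q (p k) = k) ->
    (forall k, R k -> D (q k) /\ p (q k) = k) ->
  cancel (dilation D R p q) (dilation R D q p).
Proof.
move=> DR RD [k []]; rewrite /dilation /=; case: asboolP => h /=.
- by have [/asboolT -> ->] := RD _ h.
- by rewrite asboolF.
- by have [/asboolT -> ->] := DR _ h.
- by rewrite asboolF.
Qed.

(** * The geometric model built from a degree map *)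

Section GeometricModel.
Variables (X Y : Type) (S : generatedBirestr Y).
Variables (deg : S -> words X) (b : X -> S).
Hypothesis deg_mor : restr_morphism deg.

Definition bar_word (w : seq X) : S := foldr (fun x s => b x * s) 1 w.

Hypothesis gen_deg : forall y, gb_assign S y =
  (gb_assign S y)^[+] * bar_word (deg (gb_assign S y)).

Let deg1 : deg 1 = [::]. Proof. by case: deg_mor. Qed.
Let degM s t : deg (s * t) = deg s ++ deg t. Proof. by case: deg_mor. Qed.
Let degS s : deg s^[*] = [::]. Proof. by case: deg_mor => _ _ ->. Qed.
Let degP s : deg s^[+] = [::]. Proof. by case: deg_mor => _ _ _ ->. Qed.

Lemma bar_word_cat u v : bar_word (u ++ v) = bar_word u * bar_word v.
Proof. by elim: u => [|x u IH] /=; rewrite ?mul1g // IH mulgA. Qed.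

(** By induction on generation: in a product, [t^+] moves left across the barred word of [s] by
    [x y^+ = (x y)^+ x], and projections have empty degree. *)
Lemma rplus_bar_word s : s = s^[+] * bar_word (deg s).
Proof.
move: s; apply: (gb_generates (g := S)) => [y||s t hs ht|s hs|s hs].
- exact: gen_deg.
- by rewrite deg1 rplus1 mul1g.
- have -> : (s * t)^[+] = s^[+] * (bar_word (deg s) * t^[+])^[+].
    by rewrite -rplusMl mulgA -hs rplusMr.
  rewrite rplusMr degM bar_word_cat.
  transitivity (s^[+] * bar_word (deg s) * (t^[+] * bar_word (deg t))).
    by rewrite -hs -ht.
  by rewrite -!mulgA (mulgA (bar_word (deg s))) mul_rplus !mulgA.
- by rewrite degS rstar_rplus mulg1.
- by rewrite degP rplusK mulg1.
Qed.

(* The words serve only to make the action of the free monoid faithful. *)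
Let K : Type := S + words X.

Definition letter_dom (x : X) (k : K) : Prop :=
  match k with inl f => f^[+] = f /\ f * (b x)^[*] = f | inr _ => True end.
Definition letter_ran (x : X) (k : K) : Prop :=
  match k with
  | inl f => f^[+] = f /\ f * (b x)^[+] = f
  | inr w => exists v, w = x :: v
  end.
Definition letter_act (x : X) (k : K) : K :=
  match k with inl f => inl (b x * f)^[+] | inr w => inr (x :: w) end.
Definition letter_coact (x : X) (k : K) : K :=
  match k with inl f => inl (f * b x)^[*] | inr w => inr (behead w) end.

(** For a projection [f] below [b^*], [(b f)^+ b = b f] and [(b f)^* = b^* f = f]. *)
Lemma letter_actK x k : letter_dom x k ->
  letter_ran x (letter_act x k) /\ letter_coact x (letter_act x k) = k.
Proof.
case: k => [f|w] /=; last by split=> //; exists w.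
case=> fP fb; split; first by rewrite rplusK rplusC rplusMle.
by rewrite -mul_rplus fP rstarM_proj // -(projC fP) ?rstar_rplus // fb.
Qed.

Lemma letter_coactK x k : letter_ran x k ->
  letter_dom x (letter_coact x k) /\ letter_act x (letter_coact x k) = k.
Proof.
case: k => [f|w] /=; last by case=> v ->.
case=> fP fb; split; first by rewrite rstar_rplus rstarMle.
by rewrite -rstar_mul (proj_rstar fP) rplusM_proj // fb.
Qed.

Let Omega : Type := K * bool.

Fixpoint word_act (w : seq X) : Omega -> Omega :=
  if w is x :: v then
    dilation (letter_dom x) (letter_ran x) (letter_act x) (letter_coact x)
      \o word_act v
  else id.
Fixpoint word_coact (w : seq X) : Omega -> Omega :=
  if w is x :: v then
    word_coact v \o
    dilation (letter_ran x) (letter_dom x) (letter_coact x) (letter_act x)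
  else id.

Lemma word_actK w : cancel (word_act w) (word_coact w).
Proof.
elim: w => //= x w IH o /=.
by rewrite (dilationK (@letter_actK x) (@letter_coactK x)) IH.
Qed.

Lemma word_coactK w : cancel (word_coact w) (word_act w).
Proof.
elim: w => //= x w IH o /=.
by rewrite IH (dilationK (@letter_coactK x) (@letter_actK x)).
Qed.

Lemma word_act_cat u v : word_act (u ++ v) = word_act u \o word_act v.
Proof. by elim: u => //= x u ->. Qed.

Lemma word_coact_cat u v : word_coact (u ++ v) = word_coact v \o word_coact u.
Proof. by elim: u => //= x u ->. Qed.

(** The word is recovered as the image of the empty word. *)
Lemma word_act_inj : injective word_act.
Proof.
suff actE w : word_act w (inr [::], false) = (inr w, false).
  by move=> u v /(congr1 (@^~ (inr [::], false))); rewrite !actE => -[].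
by elim: w => //= x w ->; rewrite /dilation /= asboolT.
Qed.

(** Below [(bar_word w)^+] each letter of [w] finds a projection in its genuine range, so the second
    copy is never entered. *)
Lemma word_coact_proj w (f : S) : f^[+] = f -> f * (bar_word w)^[+] = f ->
  word_coact w (inl f, false) = (inl (f * bar_word w)^[*], false).
Proof.
elim: w f => [|x w IH] f fP fw /=; first by rewrite mulg1 -fP rplus_rstar.
have fx : f * (b x)^[+] = f by rewrite -fw /= -mulgA (rplusC _ (b x)) rplusMle.
rewrite /dilation /= asboolT // IH ?rstar_rplus // ?rstarMl ?mulgA //.
by rewrite -rstarM_proj ?rplusK // -mulgA mul_rplus mulgA fw.
Qed.

Definition ideal (e : S) (o : Omega) : Prop :=
  exists2 f : S, o = (inl f, false) & f^[+] = f /\ f * e = f.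

Lemma ideal_inj s t : ideal s^[+] = ideal t^[+] -> s^[+] = t^[+].
Proof.
move=> st.
have ideal_top u : ideal u^[+] (inl u^[+], false).
  by exists u^[+] => //; rewrite rplusK rplus_idem.
have := ideal_top t; rewrite -st => -[_ [<-] [_ ts]].
have := ideal_top s; rewrite st => -[_ [<-] [_ <-]].
by rewrite rplusC.
Qed.

(** Here [s^+] lies below the projection of its barred word, and [h s = h s^+ bar_word (deg s) = h
    bar_word (deg s)]. *)
Lemma word_coact_deg s (h : S) : h^[+] = h -> h * s^[+] = h ->
  word_coact (deg s) (inl h, false) = (inl (h * s)^[*], false).
Proof.
move=> hP hs.
have sle : s^[+] * (bar_word (deg s))^[+] = s^[+].
  by rewrite -rplusMl -rplus_bar_word.
rewrite word_coact_proj //; last by rewrite -hs -mulgA sle.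
by rewrite [in RHS](rplus_bar_word s) mulgA hs.
Qed.

Definition cell (s : S) : triple Omega :=
  (ideal s^[+], word_act (deg s), word_coact (deg s)).

Lemma cell1 : cell 1 = tone (ideal 1).
Proof. by rewrite /cell deg1 rplus1. Qed.

Lemma cellM s t : cell (s * t) = tmul (cell s) (cell t).
Proof.
rewrite /cell /tmul /= degM word_act_cat word_coact_cat; congr (_, _, _).
apply/funext => o; apply/propext; split=> [[h -> [hP hst]]|].
- have hs : h * s^[+] = h by rewrite -hst -mulgA (rplusC _ s) rplusMle.
  split; first by exists h.
  rewrite word_coact_deg //; exists (h * s)^[*] => //.
  split; first exact: rstar_rplus.
  by rewrite -rstarM_proj ?rplusK // -mulgA mul_rplus mulgA hst.
- case=> -[h -> [hP hs]]; rewrite word_coact_deg // => -[_ [<-] [_ hst]].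
  exists h => //; split=> //.
  (* As [(h s)^*] is below [t^+], [h (s t)^+ = (h s t^+)^+ = (h s)^+ = h s^+ = h]. *)
  rewrite -rplusM_proj // mulgA -rplusMr -(mulg_rstar (h * s)) -mulgA hst.
  by rewrite mulg_rstar rplusM_proj.
Qed.

Lemma cell_plus s : cell s^[+] = tmul (cell s) (tinv (cell s)).
Proof.
rewrite /cell /tmul /tinv /= degP rplusK.
congr (_, _, _); apply/funext => o /=; rewrite ?word_coactK //.
by apply/propext; split=> [|[]].
Qed.

Lemma cell_star s : cell s^[*] = tmul (tinv (cell s)) (cell s).
Proof.
rewrite /cell /tmul /tinv /= degS rstar_rplus.
congr (_, _, _); apply/funext => o /=; rewrite ?word_actK //.
apply/propext; split=> [[k oE [kP ks]]|[[h /(congr1 (word_coact (deg s)))]]].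
- suff H : ideal s^[+] (word_act (deg s) o) by [].
  have hle : (s * k)^[+] * s^[+] = (s * k)^[+] by rewrite rplusC rplusMle.
  (* The image of [k] is guessed as [(s k)^+] and checked by coacting: [(s k)^+ s = s k], and
     [(s k)^* = s^* k = k]. *)
  exists (s * k)^[+]; last by rewrite rplusK.
  rewrite -[RHS](word_coactK (deg s)) word_coact_deg ?rplusK // oE.
  by rewrite -mul_rplus kP rstarM_proj // -(projC kP) ?rstar_rplus // ks.
- rewrite word_actK => -> [hP hs] _; rewrite word_coact_deg //.
  by exists (h * s)^[*] => //; rewrite rstar_rplus rstarMle.
Qed.

Lemma cell_inj : injective cell.
Proof.
move=> s t [/ideal_inj st /word_act_inj degst _].
by rewrite (rplus_bar_word s) st degst -rplus_bar_word.
Qed.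

Lemma cell_wf s : wf_triple (ideal 1) (cell s).
Proof.
split; [exact: word_actK|exact: word_coactK|] => _ [h -> [hP hs]] /=.
rewrite word_coact_deg //; split; first by exists h => //; rewrite mulg1.
by exists (h * s)^[*] => //; rewrite mulg1 rstar_rplus.
Qed.

Let j (y : Y) := cell (gb_assign S y).

Lemma cell_span s : in_span (ideal 1) j (cell s).
Proof.
move: s; apply: (gb_generates (g := S)) => [y||s t hs ht|s hs|s hs].
- exact: (span_gen _ j y).
- by rewrite cell1; exact: span_one.
- by rewrite cellM; exact: span_mul.
- by rewrite cell_star; apply: span_mul => //; exact: span_inv.
- by rewrite cell_plus; apply: span_mul => //; exact: span_inv.
Qed.

Lemma geometric_model_of_degree : admits_geometric_model S.
Proof.
pose M := GeneratedInverse
  (@span_generates _ _ _ _ (fun y => cell_wf (gb_assign S y))).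
exists M, (fun s => exist _ (cell s) (cell_span s)); split.
- exact: span_E_unitary.
- split=> [|s t|s|s]; apply: span_inj.
  + exact: cell1.
  + exact: cellM.
  + by rewrite rstarE; exact: cell_star.
  + by rewrite rplusE; exact: cell_plus.
- by move=> s t /(congr1 sval) /cell_inj.
- by move=> y; exact: span_inj.
Qed.

End GeometricModel.

(** * Degrees and normal forms of the generators in the two presentations *)

Lemma Fp_geometric_model (X : Type) : admits_geometric_model (Fp X).
Proof.
pose i (y : X + X) : words X := match y with inl x | inr x => [:: x] end.
have [|deg deg_mor degE] := @BRestr_lift _ (@Fp_rel X) (words X) i.
  by move=> h [_ hM hS _] hE _ _ [x]; rewrite hM hS !hE.
apply: (geometric_model_of_degree (b := fun x => gb_assign (Fp X) (inr x))
  deg_mor) => -[x|x]; rewrite degE /= mulg1 ?rplus_mulg //.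
(* The relation makes [x] equal to [x^+] times its barred letter, the normal form asked of a
   generator. *)
apply: natural_ge_rplus.
have [_ pM pS _] := pi_restr_morphism (@Fp_rel X).
rewrite /natural_ge /= -pS -pM; apply/quot_eqP/gc_base.
exact: Fp_ge.
Qed.

Lemma calFp_geometric_model (X : Type) : admits_geometric_model (calFp X).
Proof.
pose i (y : X + freeSemigroup X) : words X :=
  match y with inl x => [:: x] | inr u => val u end.
have [|deg deg_mor degE] := @BRestr_lift _ (@calFp_rel X) (words X) i.
  by move=> h [_ hM hS _] hE _ _ [x|u v]; rewrite ?hM ?hS !hE.
have [_ pM pS _] := pi_restr_morphism (@calFp_rel X).
pose b x := gb_assign (calFp X) (inr (letter x)).
have barE (u : freeSemigroup X) :
    gb_assign (calFp X) (inr u) = bar_word b (val u).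
  (* Induction on the tail, splitting off the first letter by the product relation; the base case is
     a single letter, as the free semigroup has no empty word. *)
  case: u => [[//|x w] pw] /=; elim: w x pw => [|y w IH] x pw /=.
    rewrite mulg1 /b; set u := exist _ _ _.
    by rewrite (_ : u = letter x :> freeSemigroup X) //; exact: val_inj.
  rewrite -(IH y isT) -pM; apply/quot_eqP/gc_base.
  set v := exist _ [:: x, y & w] _; set u := exist _ (y :: w) _.
  by rewrite (_ : v = letter x * u :> freeSemigroup X);
    [exact: calFp_mul|exact: val_inj].
apply: (geometric_model_of_degree (b := b) deg_mor) => -[x|u]; rewrite degE /=.
- rewrite mulg1; apply: natural_ge_rplus.
  rewrite /natural_ge /= -pS -pM; apply/quot_eqP/gc_base.
  exact: calFp_ge.
- by rewrite -barE rplus_mulg.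
Qed.

Theorem theorem11p9 (X : Type) (X_nonempty : inhabited X) :
  admits_geometric_model (Fp X) /\ admits_geometric_model (calFp X).
Proof. by split; [exact: Fp_geometric_model|exact: calFp_geometric_model]. Qed.
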